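(* Let $\Sigma=\{a,b\}$. Then $\{a^nb^n\mid n\in\mathbb{N}\}\in D_1(\text{s-LSTM})$: there exist an s-LSTM over $\Sigma$ with state dimension $k$, and $\mathbf w\in\mathbb{Q}^k$, $\beta\in\mathbb{Q}$, such that for all $x\in\Sigma^*$: $\mathbf w\cdot\mathbf h_{|x|}+\beta>0$ if and only if $x\in\{a^nb^n\mid n\in\mathbb{N}\}$, where $\mathbf h_{|x|}$ is the final state of the s-LSTM on $x$.
   Context: $\mathbb{N}=\{0,1,2,\dots\}$. LSTM: with an embedding $\Sigma\to\mathbb{Q}^{d_x}$, $x_t \mapsto \mathbf{x}_t$, rational matrices $\mathbf W^\bullet,\mathbf U^\bullet$ and rational bias vectors (suppressed in notation but allowed in every affine map), and $\mathbf h_0=\mathbf c_0=\mathbf 0$, $\mathbf f_t = \sigma(\mathbf W^f\mathbf x_t+\mathbf U^f\mathbf h_{t-1})$, $\mathbf i_t = \sigma(\mathbf W^i\mathbf x_t+\mathbf U^i\mathbf h_{t-1})$, $\mathbf o_t = \sigma(\mathbf W^o\mathbf x_t+\mathbf U^o\mathbf h_{t-1})$, $\tilde{\mathbf c}_t = \tanh(\mathbf W^c\mathbf x_t+\mathbf U^c\mathbf h_{t-1})$, $\mathbf c_t = \mathbf f_t\odot\mathbf c_{t-1}+\mathbf i_t\odot\tilde{\mathbf c}_t$, $\mathbf h_t=\mathbf o_t\odot\tanh(\mathbf c_t)$. Saturation: the s-LSTM is the LSTM in which $\sigma$ is replaced by the step function equal to $1$ on positive and $0$ on negative arguments, and $\tanh$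 by the sign function with values in $\{-1,0,1\}$; parameters are such that no argument of a $\sigma$ is exactly $0$ on any input, so all gates lie in $\{0,1\}$. $D_1(E)$ is the set of languages decided by an encoder of type $E$ followed by a linear threshold decoder $\mathbf d_1(\mathbf h)=\mathbb{1}_{>0}(\mathbf w\cdot\mathbf h+\beta)$ applied to the final state. *)

(* Defs.v *)
From mathcomp Require Import all_boot all_order all_algebra.

Set Implicit Arguments.
Unset Strict Implicit.
Unset Printing Implicit Defensive.

Import Order.TTheory GRing.Theory Num.Theory.
Local Open Scope ring_scope.

Record affine_gate (dx k : nat) := AffineGate {
  gate_W : 'M[rat]_(k, dx);
  gate_U : 'M[rat]_(k, k);
  gate_b : 'cV[rat]_k
}.

Definition preact dx k (g : affine_gate dx k)
    (x : 'cV[rat]_dx) (h : 'cV[rat]_k) : 'cV[rat]_k :=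
  gate_W g *m x + gate_U g *m h + gate_b g.

Record lstm (Sigma : Type) (dx k : nat) := LSTM {
  embed : Sigma -> 'cV[rat]_dx;
  gate_f : affine_gate dx k;
  gate_i : affine_gate dx k;
  gate_o : affine_gate dx k;
  gate_c : affine_gate dx k
}.

Record lstm_state (k : nat) := LSTMState {
  hidden : 'cV[rat]_k;
  cell : 'cV[rat]_k
}.

Definition hadamard k (u v : 'cV[rat]_k) : 'cV[rat]_k := map2_mx *%R u v.

(* The recurrence is parameterized by the activations [sig] and [th], which
   play the roles of the logistic function and of tanh. *)
Definition lstm_step (sig th : rat -> rat) Sigma dx k (M : lstm Sigma dx k)
    (s : lstm_state k) (t : Sigma) : lstm_state k :=
  let x := embed M t in
  let h := hidden s in
  let f := map_mx sig (preact (gate_f M) x h) in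
  let i := map_mx sig (preact (gate_i M) x h) in
  let o := map_mx sig (preact (gate_o M) x h) in
  let c' := map_mx th (preact (gate_c M) x h) in
  let c := hadamard f (cell s) + hadamard i c' in
  LSTMState (hadamard o (map_mx th c)) c.

Definition lstm_run (sig th : rat -> rat) Sigma dx k (M : lstm Sigma dx k)
    (x : seq Sigma) : lstm_state k :=
  foldl (lstm_step sig th M) (LSTMState 0 0) x.

(* The value at 0 is immaterial: [slstm_admissible] rules out this argument. *)
Definition heaviside (r : rat) : rat := if 0 < r then 1 else 0.

Definition slstm_run Sigma dx k (M : lstm Sigma dx k) (x : seq Sigma) :=
  lstm_run heaviside Num.sg M x.

(* Every time step on every input consists in reading a letter [t] after a
   prefix [x]. *)
Definition slstm_admissible Sigma dx k (M : lstm Sigma dx k) : Prop :=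
  forall (x : seq Sigma) (t : Sigma) (j : 'I_k),
    let h := hidden (slstm_run M x) in
    [/\ preact (gate_f M) (embed M t) h j 0 != 0,
        preact (gate_i M) (embed M t) h j 0 != 0
      & preact (gate_o M) (embed M t) h j 0 != 0].

Definition language (Sigma : Type) := seq Sigma -> Prop.

(* An encoder maps a word to its final state; an encoder type is a class of
   such maps, for each state dimension. *)
Definition encoder (Sigma : Type) (k : nat) := seq Sigma -> 'cV[rat]_k.
Definition encoder_type (Sigma : Type) :=
  forall k : nat, encoder Sigma k -> Prop.

Definition slstm_encoder (Sigma : Type) : encoder_type Sigma :=
  fun k enc => exists (dx : nat) (M : lstm Sigma dx k),
    slstm_admissible M /\ forall x, enc x = hidden (slstm_run M x).

Definition threshold_decoder k (w : 'rV[rat]_k) (beta : rat)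
    (h : 'cV[rat]_k) : bool :=
  0 < (w *m h) 0 0 + beta.

Definition D1 (Sigma : Type) (E : encoder_type Sigma) (L : language Sigma) :
    Prop :=
  exists (k : nat) (enc : encoder Sigma k) (w : 'rV[rat]_k) (beta : rat),
    E k enc /\ forall x, threshold_decoder w beta (enc x) <-> L x.

Inductive letter := letter_a | letter_b.

Definition anbn : language letter :=
  fun x => exists n : nat, x = nseq n letter_a ++ nseq n letter_b.

(* Main.v *)
(** Four cells suffice: the number of [a]s minus the number of [b]s, the number
    of [b]s, and two violation counters, which increase when a [b] is read while
    the difference is not positive, and when an [a] is read after some [b].
    As no counter but the first ever decreases, a violation is remembered
    forever, and a word without violation is [a^n b^m] with [m <= n].  For such
    words the sign of the difference is [0] or [1], so that the one-sided test
    [sign < 1] detects equality. *)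
Require Import Defs.
From mathcomp Require Import all_boot all_order all_algebra.
From mathcomp Require Import lra.

Set Implicit Arguments.
Unset Strict Implicit.
Unset Printing Implicit Defensive.

Import Order.TTheory GRing.Theory Num.Theory.
Local Open Scope ring_scope.

Lemma nseqSr T n (x : T) : nseq n.+1 x = rcons (nseq n x) x.
Proof. by elim: n => //= n ->. Qed.

Definition col4 (a b c d : rat) : 'cV[rat]_4 :=
  \col_j [:: a; b; c; d]`_j.

Definition sign_of_letter (t : letter) : rat :=
  if t is letter_a then 1 else -1.

Definition is_b (t : letter) : bool := if t is letter_b then true else false.

(** Used for both the forget and the output gate: cells only accumulate, and [h] is exactly the sign
    of [c]. *)
Definition open_gate : affine_gate 1 4 := AffineGate 0 0 (const_mx 1).

(* With x = 1 on [a] and x = -1 on [b], the four arguments are 1, -x,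
   -x - h_0 - 1/2 and x + 2 h_1 - 2; none of them vanishes when the h_j are
   signs. *)
Definition input_gate : affine_gate 1 4 :=
  AffineGate (col4 0 (-1) (-1) 1)
    (\matrix_(i, j) (2 *+ ((i == 3 :> nat) && (j == 1 :> nat))
                     - 1 *+ ((i == 2 :> nat) && (j == 0 :> nat))))
    (col4 1 0 (- 2^-1) (-2)).

(** Only cell 0 has a letter-dependent candidate, of value [1] or [-1]; in the other cells the
    candidate is [1], so the input gate alone decides whether they grow. *)
Definition candidate_gate : affine_gate 1 4 :=
  AffineGate (col4 1 0 0 0) 0 (col4 0 1 1 1).

Definition anbn_lstm : lstm letter 1 4 :=
  LSTM (fun t => const_mx (sign_of_letter t))
    open_gate input_gate open_gate candidate_gate.

Definition state_of (c : 'cV[rat]_4) : lstm_state 4 :=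
  LSTMState (map_mx Num.sg c) c.

Definition count (c : 'cV[rat]_4) (t : letter) : 'cV[rat]_4 :=
  c + col4 (sign_of_letter t) (is_b t)%:R
        (is_b t && (c 0 0 <= 0))%:R (~~ is_b t && (0 < c 1 0))%:R.

Lemma preact_open_gate x h : preact open_gate x h = const_mx 1.
Proof. by rewrite /preact /= !mul0mx !add0r. Qed.

Lemma preact_input_gate t h :
  let x := sign_of_letter t in
  preact input_gate (const_mx x) h =
  col4 1 (- x) (- x - h 0 0 - 2^-1) (x + 2 * h 1 0 - 2).
Proof.
move=> x; apply/matrixP => i j; rewrite ord1 {j} !mxE big_ord1.
rewrite !big_ord_recl big_ord0 !mxE /=.
have -> : lift ord0 (ord0 : 'I_3) = 1 by apply/val_inj.
by case: i => -[|[|[|[|//]]]] ? /=; lra.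
Qed.

Lemma preact_candidate_gate t h :
  preact candidate_gate (const_mx (sign_of_letter t)) h =
  col4 (sign_of_letter t) 1 1 1.
Proof.
apply/matrixP => i j; rewrite ord1 {j} /preact /= mul0mx !mxE big_ord1 !mxE.
by case: i => -[|[|[|[|//]]]] ? /=; lra.
Qed.

(** On signs, input argument 2 is positive only for [x = -1] and [h_0 <= 0], and argument 3 only for
    [x = 1] and [h_1 = 1]. These are the two violation conditions of [count], which depend on [c]
    through its signs only. *)
Lemma step_state_of c t :
  lstm_step heaviside Num.sg anbn_lstm (state_of c) t = state_of (count c t).
Proof.
rewrite /lstm_step /=.
set c' := hadamard _ c + _; have -> : c' = count c t.
  rewrite {}/c' preact_open_gate preact_input_gate preact_candidate_gate.
  apply/matrixP => i j; rewrite ord1 {j} !mxE /heaviside ltr01.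
  rewrite mul1r; congr (_ + _).
  case: i => -[|[|[|[|//]]]] ? /=; case: t => /=;
    case: sgrP => ? //=; try case: sgrP => ? //=; try case: ltrP => ? //=; lra.
rewrite preact_open_gate; congr LSTMState; apply/matrixP => i j.
by rewrite !mxE /heaviside ltr01 mul1r.
Qed.

Lemma run_state_of x : slstm_run anbn_lstm x = state_of (foldl count 0 x).
Proof.
elim/last_ind: x => [|x t IHx].
  by congr LSTMState; apply/matrixP => i j; rewrite !mxE sgr0.
rewrite foldl_rcons -step_state_of -IHx.
by rewrite /slstm_run /lstm_run foldl_rcons.
Qed.

(** Since [x] is [1] or [-1] and each [h_j] is an integer, argument 2 of the input gate is half an
    odd integer and argument 3 is an odd integer. *)
Lemma anbn_lstm_admissible : slstm_admissible anbn_lstm.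
Proof.
move=> x t j /=; rewrite run_state_of /=.
rewrite !preact_open_gate preact_input_gate !mxE oner_eq0; split=> //.
case: j => -[|[|[|[|//]]]] ? //=; case: t => //=;
  by case: sgrP => _; apply/eqP; lra.
Qed.

Lemma count_as_bs n m : (m <= n)%N ->
  foldl count 0 (nseq n letter_a ++ nseq m letter_b) =
  col4 (n%:R - m%:R) m%:R 0 0.
Proof.
elim: m => [_|m IHm lt_mn].
  rewrite cats0; elim: n => [|n IHn].
    by apply/matrixP => -[[|[|[|[|//]]]] ?] j; rewrite !mxE /= ?subr0.
  rewrite nseqSr foldl_rcons IHn /count !mxE /=.
  apply/matrixP => -[[|[|[|[|//]]]] ?] j; rewrite !mxE /= ?natrD; lra.
(* Before this [b] the difference [n - m] is still positive, so cell 2 stays at 0. *)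
rewrite nseqSr -rcons_cat foldl_rcons IHm ?(ltnW lt_mn) //.
rewrite /count !mxE /= subr_le0 ler_nat leqNgt lt_mn /=.
by apply/matrixP => -[[|[|[|[|//]]]] ?] j; rewrite !mxE /= ?natrD; lra.
Qed.

Lemma as_bs_or_violation x :
  let c := foldl count 0 x in
  (exists n m, (m <= n)%N /\ x = nseq n letter_a ++ nseq m letter_b) \/
  [/\ 0 <= c (inord 2) 0, 0 <= c (inord 3) 0
    & 0 < c (inord 2) 0 + c (inord 3) 0].
Proof.
elim/last_ind: x => [|x t IHx] c; first by left; exists 0, 0.
rewrite {}/c foldl_rcons; case: IHx => [[n [m [le_mn ->]]]|[ge2 ge3 gt0]]; last first.
  right; move: (foldl count 0 x) ge2 ge3 gt0 => c ge2 ge3 gt0.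
  rewrite /count !mxE !inordK //= !addr_ge0 ?ler0n // addrACA.
  by rewrite ltr_wpDr ?addr_ge0 ?ler0n.
rewrite count_as_bs // /count !mxE !inordK //=.
case: t => /=; rewrite ?subr_le0 ?ler_nat ?ltr0n.
  (* An [a] extends a block of [a]s, or follows some [b] and raises cell 3. *)
  case: m le_mn => [|m] le_mn; last by right; rewrite !add0r ler01 ltr01.
  by left; exists n.+1, 0; split; rewrite // !cats0 nseqSr.
(* A [b] raises cell 2 exactly when the difference is already exhausted. *)
case: leqP => lt_mn; first by right; rewrite !add0r ler01 ltr01.
by left; exists n, m.+1; split; rewrite // rcons_cat -nseqSr.
Qed.

(** The weight 2 lets one violation outweigh a difference of sign [-1]: the sum tested in [decoderE]
    is then at least [-1 + 2 = 1]. The bias [2^-1] separates the values 0 and 1. *)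
Definition anbn_weights : 'rV[rat]_4 := (col4 (-1) 0 (-2) (-2))^T.

Lemma decoderE (c : 'cV[rat]_4) :
  threshold_decoder anbn_weights 2^-1 (map_mx Num.sg c) =
  (Num.sg (c 0 0) + 2 * Num.sg (c (inord 2) 0) + 2 * Num.sg (c (inord 3) 0)
     < 2^-1).
Proof.
rewrite /threshold_decoder mxE !big_ord_recl big_ord0 !mxE /=.
have -> : lift ord0 (lift ord0 (ord0 : 'I_2)) = inord 2.
  by apply/val_inj; rewrite /= inordK.
have -> : lift ord0 (lift ord0 (lift ord0 (ord0 : 'I_1))) = inord 3.
  by apply/val_inj; rewrite /= inordK.
by apply/idP/idP => ?; lra.
Qed.

Lemma decoder_as_bs n m : (m <= n)%N ->
  threshold_decoder anbn_weights 2^-1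
    (hidden (slstm_run anbn_lstm (nseq n letter_a ++ nseq m letter_b)))
  = (n == m).
Proof.
move=> le_mn; rewrite run_state_of decoderE count_as_bs // !mxE !inordK //= sgr0.
case: ltngtP le_mn => // [lt_mn|->] _; last by rewrite subrr sgr0; lra.
by rewrite gtr0_sg ?subr_gt0 ?ltr_nat //; apply/negbTE; lra.
Qed.

Lemma decoder_violation (c : 'cV[rat]_4) :
  0 <= c (inord 2) 0 -> 0 <= c (inord 3) 0 ->
  0 < c (inord 2) 0 + c (inord 3) 0 ->
  ~~ threshold_decoder anbn_weights 2^-1 (map_mx Num.sg c).
Proof.
rewrite decoderE.
by case: (sgrP (c 0 0)) => ?; case: (sgrP (c (inord 2) 0)) => ?;
  case: (sgrP (c (inord 3) 0)) => ? ? ? ?; lra.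
Qed.

Theorem theorem13 : D1 (@slstm_encoder letter) anbn.
Proof.
exists 4, (fun x => hidden (slstm_run anbn_lstm x)), anbn_weights, 2^-1; split.
  by exists 1, anbn_lstm; split=> //; apply: anbn_lstm_admissible.
move=> x; split=> [|[n ->]]; last by rewrite decoder_as_bs ?eqxx.
have [[n [m [le_mn ->]]]|[ge2 ge3 gt0]] := as_bs_or_violation x.
  by rewrite decoder_as_bs // => /eqP ->; exists m.
by rewrite run_state_of (negbTE (decoder_violation ge2 ge3 gt0)).
Qed.
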